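(* Let $(Y_i,T_i)_{i\in\mathbb{N}}$ be a submartingale in $L^1(T)$. Let $(a_i)_{i\in\mathbb{N}}$ be a non-decreasing sequence of positive real numbers and let $g\in R(T_1)$ with $g\ge 0$. Then for every $n\in\mathbb{N}$ $$T_1(I-U_n)g\le \frac{Y_1^+}{a_1}+\sum_{i=1}^{n-1}T_1\left[\frac{Y_{i+1}^+-Y_i^+}{a_{i+1}}\right],$$ where $U_n:=\prod_{i=1}^n P_{\left(g-\frac{Y_i}{a_i}\right)^+}=P_{\left(g-\bigvee_{i=1}^n\frac{Y_i}{a_i}\right)^+}$.
   Context: A conditional expectation (operator) on a Dedekind complete Riesz space $F$ with weak order unit is a positive order continuous linear projection on $F$ that maps weak order units to weak order units and whose range is a Dedekind complete Riesz subspace of $F$. It is strictly positive if $T|f|=0$ implies $f=0$. $R(T)$ denotes the range of $T$. Let $E$ be a Dedekind complete Riesz space with weak order unit $e$, let $E^u$ be its universal completion, and let $T$ be a strictly positive conditional expectation on $E$. The natural domain of $T$ is $L^1(T)=\mathrm{dom}(T)-\mathrm{dom}(T)\subset E^u$, where $f\in\mathrm{dom}(T)$ if $f\in E^u_+$ and there is an upwards directed net $f_\alpha\uparrow f$ in $E_+$ with $(Tf_\alpha)$ order bounded in $E^u$; in this case $Tf$ is the order limit in $E^u$ of $Tf_\alpha$. $T$ is extended in this way to a conditional expectation on $L^1(T)$, which is a Dedekind complete Riesz space with weak order unit $e$. A filtration on $L^1(T)$ is a family $(T_i)_{i\in\mathbb{N}}$ of conditional expectations on $L^1(T)$ with $T_iT_j=T_jT_i=T_i$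 for all $i<j$. A submartingale $(Y_i,T_i)_{i\in\mathbb{N}}$ in $L^1(T)$ consists of a filtration $(T_i)$ on $L^1(T)$ and elements $Y_i\in L^1(T)$ with $Y_i\in R(T_i)$ for all $i$ and $T_iY_j\ge Y_i$ for $i<j$. For $h\ge 0$, $P_h$ denotes the band projection onto the band generated by $h$; $I$ is the identity operator; $x^+=x\vee 0$. An empty sum is $0$. *)

(* Defs.v *)
From HB Require Import structures.
From mathcomp Require Import all_boot all_order all_algebra.
From mathcomp Require Import all_classical reals.

Set Implicit Arguments.
Unset Strict Implicit.
Unset Printing Implicit Defensive.

Import Order.TTheory GRing.Theory Num.Theory.
Local Open Scope classical_set_scope.
Local Open Scope ring_scope.

(* The lattice operations are carried by the mixin instead of being inherited
   from [Order.Lattice], because the join of [Order.Lattice] with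
   [GRing.Zmodule] cannot be declared above the existing [Num.RealDomain]. *)
HB.mixin Record isRiesz (R : realType) V
    of Num.POrderedZmodule V & GRing.Lmodule R V := {
  rjoin : V -> V -> V;
  rmeet : V -> V -> V;
  rjoinP : forall x y z : V, (rjoin x y <= z) = (x <= z) && (y <= z);
  rmeetP : forall x y z : V, (z <= rmeet x y) = (z <= x) && (z <= y);
  riesz_leD2r : forall x y z : V, x <= y -> x + z <= y + z;
  riesz_scale_ge0 : forall (a : R) (x : V), 0 <= a -> 0 <= x -> 0 <= a *: x
}.

#[short(type="rieszType")]
HB.structure Definition Riesz (R : realType) :=
  { V of Num.POrderedZmodule V & GRing.Lmodule R V & isRiesz R V }.

Section Riesz_notions.
Context (R : realType) (V : rieszType R).
Implicit Types (x y h e : V) (A B D : set V).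

Definition rpos x : V := rjoin x 0.

Definition rabs x : V := rjoin x (- x).

Definition rdisjoint x y : Prop := rmeet (rabs x) (rabs y) = 0.

Definition dedekind_complete : Prop :=
  forall A, A !=set0 -> has_ubound A -> supremums A !=set0.

Definition laterally_complete : Prop :=
  forall A, A !=set0 -> A `<=` [set x | 0 <= x] ->
    (forall x y, A x -> A y -> x <> y -> rdisjoint x y) -> supremums A !=set0.

Definition universally_complete : Prop :=
  dedekind_complete /\ laterally_complete.

Definition order_bounded A : Prop := has_lbound A /\ has_ubound A.

Definition directed_up D : Prop :=
  D !=set0 /\ forall x y, D x -> D y -> exists2 z, D z & x <= z /\ y <= z.

Definition directed_down D : Prop :=
  D !=set0 /\ forall x y, D x -> D y -> exists2 z, D z & z <= x /\ z <= y.

Record riesz_subspace A : Prop := RieszSubspace {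
  riesz_subspace0 : A 0;
  riesz_subspaceP : forall (a : R) x y, A x -> A y -> A (a *: x + y);
  riesz_subspaceU : forall x y, A x -> A y -> A (rjoin x y);
  riesz_subspaceI : forall x y, A x -> A y -> A (rmeet x y)
}.

Record band B : Prop := Band {
  band0 : B 0;
  bandP : forall (a : R) x y, B x -> B y -> B (a *: x + y);
  band_solid : forall x y, rabs x <= rabs y -> B y -> B x;
  band_sup : forall D x, D `<=` B -> supremums D x -> B x
}.

Definition band_gen h : set V := \bigcap_(B in [set B | band B /\ B h]) B.

(* When [B] is a projection band (every band is one if [V] is Dedekind
   complete), each [x] is uniquely [y + z] with [y] in [B] and [z] disjoint
   from [B]; the projection is [y]. *)
Definition band_proj B x : V :=
  xget 0 [set y | B y /\ forall z, B z -> rdisjoint (x - y) z].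

(* P_h *)
Definition bproj h : V -> V := band_proj (band_gen h).

Definition weak_order_unit e : Prop := 0 <= e /\ band_gen e = setT.

End Riesz_notions.

Arguments dedekind_complete {R} V.
Arguments laterally_complete {R} V.
Arguments universally_complete {R} V.

Section Riesz_subtype.
Context (R : realType) (V : rieszType R) (A : set V) (hA : riesz_subspace A).

(* A Riesz subspace as a Riesz space, for the induced order. *)
Definition sub_riesz (_ : riesz_subspace A) : Type := {x : V | x \in A}.

Notation S := (sub_riesz hA).

HB.instance Definition _ := [isSub of S for @sval V (fun x => x \in A)].
HB.instance Definition _ := [Choice of S by <:].

Fact sub_riesz_submod : submod_closed [in A].
Proof.
split=> [|a x y /set_mem Ax /set_mem Ay]; rewrite inE /=.
  exact: riesz_subspace0 hA.
exact: riesz_subspaceP.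
Qed.

HB.instance Definition _ :=
  GRing.SubChoice_isSubLmodule.Build R V [in A] S sub_riesz_submod.

HB.instance Definition _ :=
  Order.SubChoice_isSubPOrder.Build _ V [in A] ring_display S.

Definition sub_rjoin (x y : S) : S :=
  Sub (rjoin (val x) (val y))
    (mem_set (riesz_subspaceU hA (set_mem (valP x)) (set_mem (valP y)))).

Definition sub_rmeet (x y : S) : S :=
  Sub (rmeet (val x) (val y))
    (mem_set (riesz_subspaceI hA (set_mem (valP x)) (set_mem (valP y)))).

Fact sub_rjoinP (x y z : S) : (sub_rjoin x y <= z) = (x <= z) && (y <= z).
Proof. by rewrite -!Order.le_val SubK rjoinP. Qed.

Fact sub_rmeetP (x y z : S) : (z <= sub_rmeet x y) = (z <= x) && (z <= y).
Proof. by rewrite -!Order.le_val SubK rmeetP. Qed.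

Fact sub_riesz_leD2r (x y z : S) : x <= y -> x + z <= y + z.
Proof. by rewrite -!Order.le_val !raddfD /=; apply: riesz_leD2r. Qed.

Fact sub_riesz_scale_ge0 (a : R) (x : S) : 0 <= a -> 0 <= x -> 0 <= a *: x.
Proof.
by rewrite -!Order.le_val !raddf0 linearZ /=; apply: riesz_scale_ge0.
Qed.

HB.instance Definition _ := isRiesz.Build R S
  sub_rjoinP sub_rmeetP sub_riesz_leD2r sub_riesz_scale_ge0.

End Riesz_subtype.

Section Conditional_expectation.
Context (R : realType) (F : rieszType R).

Definition positive_op (T : F -> F) : Prop := forall x, 0 <= x -> 0 <= T x.

Definition order_continuous (T : F -> F) : Prop :=
  forall D : set F, directed_down D -> infimums D 0 ->
    infimums [set rabs (T x) | x in D] 0.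

Record cond_exp (T : {linear F -> F}) : Prop := CondExp {
  cond_exp_pos : positive_op T;
  cond_exp_cont : order_continuous T;
  cond_exp_proj : forall x, T (T x) = T x;
  cond_exp_unit : forall e, weak_order_unit e -> weak_order_unit (T e);
  cond_exp_range :
    exists h : riesz_subspace (range T), dedekind_complete (sub_riesz h)
}.

Definition strictly_positive (T : F -> F) : Prop :=
  forall x, T (rabs x) = 0 -> x = 0.

(* Time is {1, 2, ...}; the operator and the variable of index 0 are junk. *)
Record filtration (Ti : nat -> {linear F -> F}) : Prop := Filtration {
  filtration_cond_exp : forall i, (0 < i)%N -> cond_exp (Ti i);
  filtration_compat : forall i j, (0 < i)%N -> (i < j)%N ->
    forall x, Ti i (Ti j x) = Ti i x /\ Ti j (Ti i x) = Ti i x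
}.

Record submartingale (Y : nat -> F) (Ti : nat -> {linear F -> F}) : Prop :=
  Submartingale {
    submartingale_filtration : filtration Ti;
    submartingale_adapted : forall i, (0 < i)%N -> range (Ti i) (Y i);
    submartingale_le : forall i j, (0 < i)%N -> (i < j)%N ->
      Y i <= Ti i (Y j)
  }.

End Conditional_expectation.

Section Natural_domain.
Context (R : realType) (E Eu : rieszType R).

(* [iota] identifies [E] with an order dense Riesz subspace of [Eu]. *)
Record universal_completion (iota : {linear E -> Eu}) : Prop :=
  UniversalCompletion {
    ucompl_complete : universally_complete Eu;
    ucompl_inj : injective iota;
    ucompl_join : forall x y, iota (rjoin x y) = rjoin (iota x) (iota y);
    ucompl_meet : forall x y, iota (rmeet x y) = rmeet (iota x) (iota y);
    ucompl_dense : forall u : Eu, 0 < u -> exists2 x : E, 0 < x & iota x <= u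
  }.

Context (iota : {linear E -> Eu}) (T : {linear E -> E}).

(* Upwards directed nets are replaced by their ranges, upwards directed sets. *)
Definition T_dom : set Eu := [set f | 0 <= f /\
  exists D : set E, [/\ D `<=` [set x | 0 <= x], directed_up D,
    supremums (iota @` D) f & order_bounded [set iota (T x) | x in D]]].

Definition natural_domain : set Eu := [set f - g | f in T_dom & g in T_dom].

End Natural_domain.

Section Riesz_lemmas.
Context (R : realType) (V : rieszType R).
Implicit Types (x y z : V).

Lemma riesz_leD x y z t : x <= y -> z <= t -> x + z <= y + t.
Proof.
move=> xy zt; apply: le_trans (riesz_leD2r _ _ z xy) _.
by rewrite ![y + _]addrC; apply: riesz_leD2r.
Qed.

Lemma riesz_leBrDr x y z : (x <= y - z) = (x + z <= y).
Proof.
apply/idP/idP => h; first by have := riesz_leD2r _ _ z h; rewrite subrK.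
by have := riesz_leD2r _ _ (- z) h; rewrite addrK.
Qed.

Lemma riesz_leBlDr x y z : (x - z <= y) = (x <= y + z).
Proof. by rewrite -{1}[y](addrK z) riesz_leBrDr subrK. Qed.

Lemma rjoinl x y : x <= rjoin x y.
Proof. by have := lexx (rjoin x y); rewrite rjoinP => /andP[]. Qed.

Lemma rjoinr x y : y <= rjoin x y.
Proof. by have := lexx (rjoin x y); rewrite rjoinP => /andP[]. Qed.

Lemma rjoinDr x y z : rjoin x y + z = rjoin (x + z) (y + z).
Proof.
apply/le_anti/andP; split; last first.
  by rewrite rjoinP !riesz_leD2r ?rjoinl ?rjoinr.
by rewrite -riesz_leBrDr rjoinP !riesz_leBrDr rjoinl rjoinr.
Qed.

Lemma rmeetE x y : rmeet x y = x + y - rjoin x y.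
Proof.
apply/le_anti/andP; split.
  have := lexx (rmeet x y); rewrite rmeetP => /andP[mx my].
  rewrite riesz_leBrDr addrC -riesz_leBrDr rjoinP !riesz_leBrDr.
  by rewrite riesz_leD // addrC riesz_leD.
by rewrite rmeetP !riesz_leBlDr riesz_leD ?rjoinr //= addrC riesz_leD ?rjoinl.
Qed.

End Riesz_lemmas.

Section Natural_domain_subspace.
Context (R : realType) (E Eu : rieszType R).
Context (iota : {linear E -> Eu}) (T : {linear E -> E}).
Hypothesis iotaU : forall x y, iota (rjoin x y) = rjoin (iota x) (iota y).
Hypothesis T_pos : positive_op T.

Let le_iota (x y : E) : x <= y -> iota x <= iota y.
Proof.
move=> xy; have -> : y = rjoin x y.
  by apply/le_anti/andP; rewrite rjoinr rjoinP xy lexx.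
by rewrite iotaU rjoinl.
Qed.

Let le_T (x y : E) : x <= y -> T x <= T y.
Proof.
move=> xy; rewrite -[T x]add0r -riesz_leBrDr -linearB.
by apply: T_pos; rewrite riesz_leBrDr add0r.
Qed.

Let dom0 : T_dom iota T 0.
Proof.
split=> //; exists [set 0]; split=> [_ ->|||] /=.
- exact: lexx.
- by split=> [|x y -> ->]; exists 0 => //; rewrite lexx.
- by rewrite image_set1 linear0 supremums1.
- by rewrite image_set1 !linear0; split; exists 0 => x ->.
Qed.

Let domD f g : T_dom iota T f -> T_dom iota T g -> T_dom iota T (f + g).
Proof.
move=> [f0 [D [D0 [[d Dd] Ddir] [Df fD] [[l Dl] [u Du]]]]].
move=> [g0 [D' [D'0 [[d' D'd] D'dir] [D'g gD'] [[l' Dl'] [u' Du']]]]].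
split; first by rewrite -[0]addr0 riesz_leD.
exists [set x + y | x in D & y in D']; split.
- by move=> _ [x Dx [y Dy <-]] /=; rewrite -[0]addr0 riesz_leD//; [exact: D0|exact: D'0].
- split; first by exists (d + d'), d => //; exists d'.
  move=> _ _ [x Dx [y Dy <-]] [x' Dx' [y' Dy' <-]].
  have [z Dz [xz x'z]] := Ddir _ _ Dx Dx'.
  have [t Dt [yt y't]] := D'dir _ _ Dy Dy'.
  by exists (z + t); [exists z => //; exists t|split; apply: riesz_leD].
- split=> [_ [_ [x Dx [y Dy <-]] <-]|w wub].
    by rewrite linearD riesz_leD//; [apply: Df; exists x|apply: D'g; exists y].
  rewrite addrC -riesz_leBrDr; apply: gD' => _ [y Dy <-].
  rewrite riesz_leBrDr addrC -riesz_leBrDr; apply: fD => _ [x Dx <-].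
  rewrite riesz_leBrDr -linearD; apply: wub.
  by exists (x + y) => //; exists x => //; exists y.
- split.
    exists (l + l') => _ [_ [x Dx [y Dy <-]] <-].
    by rewrite !linearD riesz_leD//; [apply: Dl; exists x|apply: Dl'; exists y].
  exists (u + u') => _ [_ [x Dx [y Dy <-]] <-].
  by rewrite !linearD riesz_leD//; [apply: Du; exists x|apply: Du'; exists y].
Qed.

Let riesz_leZ (W : rieszType R) (a : R) (x y : W) :
  0 <= a -> x <= y -> a *: x <= a *: y.
Proof.
move=> a0 xy; rewrite -[a *: x]add0r -riesz_leBrDr -scalerBr.
by apply: riesz_scale_ge0 => //; rewrite riesz_leBrDr add0r.
Qed.

Let domZ (a : R) f : 0 <= a -> T_dom iota T f -> T_dom iota T (a *: f).
Proof.
rewrite le_eqVlt => /orP[/eqP <- _|a0]; first by rewrite scale0r.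
move=> [f0 [D [D0 [[d Dd] Ddir] [Df fD] [[l Dl] [u Du]]]]].
split; first by rewrite riesz_scale_ge0// ltW.
exists [set a *: x | x in D]; split.
- by move=> _ [x Dx <-] /=; apply: riesz_scale_ge0; [exact: ltW|exact: D0].
- split; first by exists (a *: d), d.
  move=> _ _ [x Dx <-] [x' Dx' <-].
  have [z Dz [xz x'z]] := Ddir _ _ Dx Dx'.
  by exists (a *: z); [exists z|split; apply: riesz_leZ => //; exact: ltW].
- split=> [_ [_ [x Dx <-] <-]|w wub].
    by rewrite linearZ riesz_leZ ?(ltW a0)//; apply: Df; exists x.
  rewrite -[w]scale1r -(divff (lt0r_neq0 a0)) -scalerA.
  apply: riesz_leZ; first exact: ltW.
  apply: fD => _ [x Dx <-].
  rewrite -[iota x]scale1r -(mulVf (lt0r_neq0 a0)) -scalerA.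
  apply: riesz_leZ; first by rewrite invr_ge0 ltW.
  by rewrite -linearZ; apply: wub; exists (a *: x) => //; exists x.
- split.
    exists (a *: l) => _ [_ [x Dx <-] <-].
    by rewrite !linearZ riesz_leZ ?(ltW a0)//; apply: Dl; exists x.
  exists (a *: u) => _ [_ [x Dx <-] <-].
  by rewrite !linearZ riesz_leZ ?(ltW a0)//; apply: Du; exists x.
Qed.

Let domU f g : T_dom iota T f -> T_dom iota T g -> T_dom iota T (rjoin f g).
Proof.
move=> [f0 [D [D0 [[d Dd] Ddir] [Df fD] [[l Dl] [u Du]]]]].
move=> [g0 [D' [D'0 [[d' D'd] D'dir] [D'g gD'] [[l' Dl'] [u' Du']]]]].
split; first by rewrite (le_trans f0)// rjoinl.
exists [set rjoin x y | x in D & y in D']; split.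
- by move=> _ [x Dx [y Dy <-]] /=; rewrite (le_trans _ (rjoinl _ _))//; exact: D0.
- split; first by exists (rjoin d d'), d => //; exists d'.
  move=> _ _ [x Dx [y Dy <-]] [x' Dx' [y' Dy' <-]].
  have [z Dz [xz x'z]] := Ddir _ _ Dx Dx'.
  have [t Dt [yt y't]] := D'dir _ _ Dy Dy'.
  exists (rjoin z t); first by exists z => //; exists t.
  split; rewrite rjoinP; apply/andP; split.
  - exact: le_trans (rjoinl z t).
  - exact: le_trans (rjoinr z t).
  - exact: le_trans (rjoinl z t).
  - exact: le_trans (rjoinr z t).
- split=> [_ [_ [x Dx [y Dy <-]] <-]|w wub].
    rewrite iotaU rjoinP (le_trans _ (rjoinl f g))/=; last by apply: Df; exists x.
    by rewrite (le_trans _ (rjoinr f g))//; apply: D'g; exists y.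
  have wub' x y : D x -> D' y -> (iota x <= w) && (iota y <= w).
    move=> Dx Dy; rewrite -rjoinP -iotaU; apply: wub.
    by exists (rjoin x y) => //; exists x => //; exists y.
  rewrite rjoinP; apply/andP; split.
    by apply: fD => _ [x Dx <-]; have /andP[] := wub' _ _ Dx D'd.
  by apply: gD' => _ [y Dy <-]; have /andP[] := wub' _ _ Dd Dy.
- split.
    exists 0 => _ [_ [x Dx [y Dy <-]] <-].
    rewrite -(linear0 iota) le_iota// T_pos//.
    by rewrite (le_trans _ (rjoinl _ _))//; exact: D0.
  exists (u + u') => _ [_ [x Dx [y Dy <-]] <-].
  apply: (@le_trans _ _ (iota (T (x + y)))).
    have x0 : 0 <= x by exact: D0.
    have y0 : 0 <= y by exact: D'0.
    apply/le_iota/le_T; rewrite rjoinP -{1}[x]addr0 riesz_leD//=.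
    by rewrite -{1}[y]add0r riesz_leD.
  by rewrite !linearD riesz_leD//; [apply: Du; exists x|apply: Du'; exists y].
Qed.

Lemma natural_domain_riesz : riesz_subspace (natural_domain iota T).
Proof.
have linL (a : R) x y : natural_domain iota T x -> natural_domain iota T y ->
    natural_domain iota T (a *: x + y).
  move=> [f df [g dg <-]] [f' df' [g' dg' <-]].
  have [a0|/ltW a0] := leP 0 a.
    exists (a *: f + f'); first by apply: domD => //; exact: domZ.
    exists (a *: g + g'); first by apply: domD => //; exact: domZ.
    by rewrite scalerBr opprD addrACA.
  rewrite -oppr_ge0 in a0.
  exists ((- a) *: g + f'); first by apply: domD => //; exact: domZ.
  exists ((- a) *: f + g'); first by apply: domD => //; exact: domZ.
  by rewrite !scaleNr opprD opprK addrACA scalerBr [- _ + _]addrC.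
have joinL x y : natural_domain iota T x -> natural_domain iota T y ->
    natural_domain iota T (rjoin x y).
  move=> [f df [g dg <-]] [f' df' [g' dg' <-]].
  exists (rjoin (f + g') (f' + g)); first by apply: domU; exact: domD.
  exists (g + g'); first exact: domD.
  rewrite rjoinDr; congr rjoin; first by rewrite opprD addrACA subrr addr0.
  by rewrite [g + g']addrC opprD addrACA subrr addr0.
split=> //; first by exists 0 => //; exists 0; rewrite ?subr0.
move=> x y Lx Ly; rewrite rmeetE -[- _]scaleN1r addrC; apply: (linL).
  exact: joinL.
by rewrite -[x]scale1r; exact: linL.
Qed.

End Natural_domain_subspace.

Section L1.
Context (R : realType) (E Eu : rieszType R).
Context (iota : {linear E -> Eu}) (T : {linear E -> E}).

(* [L^1(T)] as a Riesz space. *)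
Definition L1 (hi : universal_completion iota) (hT : cond_exp T) : rieszType R :=
  sub_riesz (natural_domain_riesz (ucompl_join hi) (cond_exp_pos hT)).

End L1.

(* Main.v *)
Require Import Defs.
From HB Require Import structures.
From mathcomp Require Import all_boot all_order all_algebra.
From mathcomp Require Import all_classical reals.

Set Implicit Arguments.
Unset Strict Implicit.
Unset Printing Implicit Defensive.

Import Order.TTheory GRing.Theory Num.Theory.
Local Open Scope classical_set_scope.
Local Open Scope ring_scope.

(** The band projection [U_n] of [g] onto [{g > Y_1 / a_1, ..., g > Y_n / a_n}] is
    a stopping device: [U_n] decreases with [n], and on the piece
    [U_(n - 1) - U_n], where [g] is first caught up by the submartingale, it is at
    most [Y_n / a_n <= Y_n^+ / a_n]. Summing the pieces by parts
    ([excess_pathwise]) bounds [(I - U_n) g] by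
    [Y_1^+ / a_1 + \sum_i U_i ((Y_(i + 1)^+ - Y_i^+) / a_(i + 1))]; no expectation
    is involved yet.

    It remains to apply [T_1] and to remove [U_i]. As [U_i] is the projection onto
    the band of an element of the range of [T_i], it commutes with [T_i]
    ([cond_exp_bproj]), so that [T_1 U_i = T_1 T_i U_i = T_1 U_i T_i]. Since [Y^+]
    is a submartingale, [T_i] makes the increment positive, and on positive
    elements [U_i] is at most the identity ([maximal_inequality]).

    The product formula for [U_n] is [P_h P_k = P_(h /\ k)] ([bproj_meet])
    combined with [(g - x \/ y)^+ = (g - x)^+ /\ (g - y)^+] ([rposBjoin]).

    All this takes place in a Dedekind complete Riesz space, where the projections
    [P_h] exist, with a weak order unit, without which the commutation of [P_h]
    with a conditional expectation may fail. That [L^1(T)] is such a space is shown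
    at the end: it is an ideal of the universal completion of [E]
    ([natural_domain_solid]), in which the unit of [E] still generates
    everything ([L1_weak_order_unit]). *)

(** * Arithmetic of Riesz spaces *)

Section RieszBasics.
Context (R : realType) (V : rieszType R).
Implicit Types (x y z h s w : V) (A B D : set V).

Lemma riesz_subr_ge0 x y : (0 <= y - x) = (x <= y).
Proof. by rewrite riesz_leBrDr add0r. Qed.

Lemma riesz_leN2 x y : (- x <= - y) = (y <= x).
Proof. by rewrite -[RHS]riesz_subr_ge0 -[LHS]riesz_subr_ge0 opprK addrC. Qed.

Lemma riesz_leD2E x y z : (x + z <= y + z) = (x <= y).
Proof. by rewrite -riesz_leBrDr addrK. Qed.

Lemma riesz_addr_ge0 x y : 0 <= x -> 0 <= y -> 0 <= x + y.
Proof. by move=> x0 y0; rewrite -[0]addr0 riesz_leD. Qed.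

Lemma riesz_leZ2l (a : R) x y : 0 <= a -> x <= y -> a *: x <= a *: y.
Proof.
move=> a0 xy; rewrite -riesz_subr_ge0 -scalerBr.
by rewrite riesz_scale_ge0 ?riesz_subr_ge0.
Qed.

Lemma riesz_leZ2r (a b : R) x : 0 <= x -> a <= b -> a *: x <= b *: x.
Proof.
move=> x0 ab; rewrite -riesz_subr_ge0 -scalerBl.
by rewrite riesz_scale_ge0 ?subr_ge0.
Qed.

Lemma riesz_mulrn_ge0 x n : 0 <= x -> 0 <= x *+ n.
Proof.
by move=> x0; elim: n => [|n IHn]; rewrite ?mulr0n// mulrS riesz_addr_ge0.
Qed.

Lemma riesz_lemuln x m n : 0 <= x -> (m <= n)%N -> x *+ m <= x *+ n.
Proof.
move=> x0 /subnKC <-; rewrite mulrnDr -{1}[x *+ m]addr0 riesz_leD//.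
exact: riesz_mulrn_ge0.
Qed.

Lemma rjoin_le x y z : x <= z -> y <= z -> rjoin x y <= z.
Proof. by rewrite rjoinP => -> ->. Qed.

Lemma rmeet_ge x y z : z <= x -> z <= y -> z <= rmeet x y.
Proof. by rewrite rmeetP => -> ->. Qed.

Lemma rmeetl x y : rmeet x y <= x.
Proof. by have := lexx (rmeet x y); rewrite rmeetP => /andP[]. Qed.

Lemma rmeetr x y : rmeet x y <= y.
Proof. by have := lexx (rmeet x y); rewrite rmeetP => /andP[]. Qed.

Lemma rmeetC x y : rmeet x y = rmeet y x.
Proof. by apply/le_anti; rewrite !rmeetP !rmeetl !rmeetr. Qed.

Lemma rjoinC x y : rjoin x y = rjoin y x.
Proof. by apply/le_anti; rewrite !rjoinP !rjoinl !rjoinr. Qed.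

Lemma rjoinA x y z : rjoin x (rjoin y z) = rjoin (rjoin x y) z.
Proof.
suff eq_le u : (rjoin x (rjoin y z) <= u) = (rjoin (rjoin x y) z <= u).
  by apply/le_anti; rewrite eq_le lexx -eq_le lexx.
by rewrite !rjoinP andbA.
Qed.

Lemma rmeet_id x y : x <= y -> rmeet x y = x.
Proof. by move=> xy; apply/le_anti; rewrite rmeetl rmeet_ge. Qed.

Lemma rmeet_le x x' y y' : x <= x' -> y <= y' -> rmeet x y <= rmeet x' y'.
Proof.
move=> xx' yy'; apply: rmeet_ge; first exact: le_trans (rmeetl _ _) xx'.
exact: le_trans (rmeetr _ _) yy'.
Qed.

Lemma rmeetDr x y z : rmeet x y + z = rmeet (x + z) (y + z).
Proof.
apply/le_anti; rewrite rmeetP !riesz_leD2E rmeetl rmeetr/=.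
by rewrite -riesz_leBlDr rmeet_ge// riesz_leBlDr ?rmeetl ?rmeetr.
Qed.

(** Substituting [d = x /\ d + x \/ d - x] turns a bound on the meets with [x]
    into a bound on [d] itself, to which the definition of [s] applies. *)
Lemma rmeet_sup_le D s x w : supremums D s ->
  (forall d, D d -> rmeet x d <= w) -> rmeet x s <= w.
Proof.
move=> [Ds sD] xdw; rewrite rmeetE riesz_leBlDr addrC -riesz_leBrDr.
apply: sD => d Dd; rewrite riesz_leBrDr addrC.
have := xdw _ Dd; rewrite rmeetE riesz_leBlDr => /le_trans -> //.
rewrite riesz_leD// rjoin_le ?rjoinl//.
by apply: le_trans (rjoinr x s); exact: Ds.
Qed.

Lemma rmeet_join_le x y z w :
  rmeet x y <= w -> rmeet x z <= w -> rmeet x (rjoin y z) <= w.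
Proof.
move=> xyw xzw; apply: (@rmeet_sup_le [set y; z]) => [|d [->|->]//].
split=> [_ [->|->]|u ub]; [exact: rjoinl|exact: rjoinr|].
by apply: rjoin_le; apply: ub; [left|right].
Qed.

Lemma rmeetD_le x y z :
  0 <= x -> 0 <= y -> 0 <= z -> rmeet (x + y) z <= rmeet x z + rmeet y z.
Proof.
move=> x0 y0 z0; rewrite rmeetDr; set m := rmeet y z.
suff le_m u : rmeet (x + y) z <= u + y -> rmeet (x + y) z <= u + z ->
    rmeet (x + y) z <= u + m.
  have le_z u v : 0 <= u -> z <= v -> rmeet (x + y) z <= u + v.
    move=> u0 zv; rewrite (le_trans (rmeetr _ _))// -[z]add0r.
    exact: riesz_leD.
  apply: rmeet_ge; apply: le_m; [exact: rmeetl|exact: le_z| |exact: le_z].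
  by rewrite [z + y]addrC le_z.
by move=> uy uz; rewrite [u + m]addrC -riesz_leBlDr; apply: rmeet_ge;
  rewrite riesz_leBlDr [_ + u]addrC.
Qed.

Lemma rpos_ge x : x <= rpos x. Proof. exact: rjoinl. Qed.

Lemma rpos_ge0 x : 0 <= rpos x. Proof. exact: rjoinr. Qed.

Lemma rposBN x : rpos x - rpos (- x) = x.
Proof.
apply/eqP; rewrite subr_eq addrC /rpos rjoinDr addNr add0r.
by apply/eqP; rewrite rjoinC.
Qed.

Lemma rposBjoin x y z :
  rpos (x - rjoin y z) = rmeet (rpos (x - y)) (rpos (x - z)).
Proof.
have -> : x - rjoin y z = rmeet (x - y) (x - z).
  have swap u v : (u <= x - v) = (v <= x - u).
    by rewrite !riesz_leBrDr addrC.
  apply/le_anti; rewrite rmeetP ![x - _]addrC !riesz_leD2E !riesz_leN2.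
  rewrite rjoinl rjoinr/= ![_ + x]addrC swap.
  by rewrite rjoin_le// swap ?rmeetl ?rmeetr.
set p := x - y; set q := x - z; apply/le_anti/andP; split.
  apply: rjoin_le; last by rewrite rmeet_ge// rpos_ge0.
  by apply: rmeet_le; exact: rpos_ge.
apply: rmeet_join_le; last by apply: le_trans (rmeetr _ _) _; exact: rpos_ge0.
rewrite rmeetC; apply: rmeet_join_le; first by rewrite rmeetC rpos_ge.
by apply: le_trans (rmeetr _ _) _; exact: rpos_ge0.
Qed.

Lemma le_rabs x : x <= rabs x. Proof. exact: rjoinl. Qed.

Lemma rabsN x : rabs (- x) = rabs x.
Proof. by rewrite /rabs opprK rjoinC. Qed.

Lemma leN_rabs x : - x <= rabs x. Proof. exact: rjoinr. Qed.

Lemma rabs_ge0 x : 0 <= rabs x.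
Proof.
have : 0 <= (2^-1 : R) *: (rabs x + rabs x).
  apply: riesz_scale_ge0; first by rewrite invr_ge0 ler0n.
  by rewrite -[0](subrr x) riesz_leD ?le_rabs ?leN_rabs.
by rewrite -mulr2n -scaler_nat scalerA mulVf ?scale1r// pnatr_eq0.
Qed.

Lemma rabs_pos x : 0 <= x -> rabs x = x.
Proof.
move=> x0; apply/le_anti; rewrite le_rabs rjoin_le//.
by rewrite (le_trans _ x0)// -[0]oppr0 riesz_leN2.
Qed.

Lemma rabsD x y : rabs (x + y) <= rabs x + rabs y.
Proof.
by apply: rjoin_le; rewrite ?opprD riesz_leD// ?le_rabs ?leN_rabs.
Qed.

Lemma rabsZ_le (a : R) x : rabs (a *: x) <= `|a| *: rabs x.
Proof.
wlog a0 : a x / 0 <= a => [hw|].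
  have [/hw//|/ltW a0] := leP 0 a.
  by rewrite -[a]opprK scaleNr -scalerN normrN -[rabs x]rabsN hw// oppr_ge0.
rewrite ger0_norm//; apply: rjoin_le; rewrite -?scalerN riesz_leZ2l//.
  exact: le_rabs.
exact: leN_rabs.
Qed.

End RieszBasics.

(** * Disjointness and bands *)

Section Disjointness.
Context (R : realType) (V : rieszType R).
Implicit Types (x y z h s w : V) (A B D : set V).

Lemma rdisjoint_sym x y : rdisjoint x y -> rdisjoint y x.
Proof. by rewrite /rdisjoint rmeetC. Qed.

Lemma rdisjointP x y : rmeet (rabs x) (rabs y) <= 0 -> rdisjoint x y.
Proof. by move=> le0; apply/le_anti; rewrite le0 rmeet_ge ?rabs_ge0. Qed.

Lemma rdisjoint_solid x y z : rabs x <= rabs y -> rdisjoint y z -> rdisjoint x z.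
Proof. by move=> xy yz; apply: rdisjointP; rewrite -yz rmeet_le. Qed.

Lemma rdisjoint_le x y z : 0 <= x -> x <= y -> rdisjoint y z -> rdisjoint x z.
Proof.
by move=> x0 xy; apply: rdisjoint_solid; rewrite !rabs_pos// (le_trans x0).
Qed.

Lemma rdisjoint_pos x y : 0 <= x -> 0 <= y -> rdisjoint x y -> rmeet x y = 0.
Proof. by move=> x0 y0; rewrite /rdisjoint !rabs_pos. Qed.

Lemma rdisjoint_self x : rdisjoint x x -> x = 0.
Proof.
rewrite /rdisjoint rmeet_id// => x0; apply/le_anti; rewrite -{1}x0 le_rabs/=.
by rewrite -riesz_leN2 oppr0 -x0 leN_rabs.
Qed.

Lemma rdisjointD x y z : rdisjoint x z -> rdisjoint y z -> rdisjoint (x + y) z.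
Proof.
move=> xz yz; apply: rdisjointP.
apply: le_trans (rmeet_le (rabsD x y) (lexx _)) _.
by rewrite (le_trans (rmeetD_le _ _ _)) ?rabs_ge0// xz yz addr0.
Qed.

(* The factor [a] is replaced by some [m >= 1, |a|], for which
   [m |x| /\ |z| <= m (|x| /\ |z|)]. *)
Lemma rdisjointZ (a : R) x z : rdisjoint x z -> rdisjoint (a *: x) z.
Proof.
move=> xz; apply: rdisjointP; set m := Num.max 1 `|a|.
have m1 : 1 <= m by rewrite le_max lexx.
have m0 : 0 < m by exact: lt_le_trans m1.
apply: (@le_trans _ _ (m *: rmeet (rabs x) (rabs z))); last first.
  by rewrite xz scaler0.
rewrite -[X in X <= _]scale1r -(divff (lt0r_neq0 m0)) -scalerA.
apply: riesz_leZ2l; first exact: ltW.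
have mV0 : 0 <= m^-1 by rewrite invr_ge0 ltW.
apply: rmeet_ge.
  apply: le_trans (riesz_leZ2l mV0 (rmeetl _ _)) _.
  rewrite -[rabs x]scale1r -(mulVf (lt0r_neq0 m0)) -scalerA.
  apply: riesz_leZ2l => //; apply: le_trans (rabsZ_le _ _) _.
  by apply: riesz_leZ2r; rewrite ?rabs_ge0// le_max lexx orbT.
apply: le_trans (riesz_leZ2l mV0 (rmeetr _ _)) _.
rewrite -[X in _ <= X]scale1r; apply: riesz_leZ2r; first exact: rabs_ge0.
by rewrite invf_le1.
Qed.

Lemma rdisjoint0 z : rdisjoint 0 z.
Proof.
have r0 : rabs 0 = 0 :> V by rewrite rabs_pos.
by rewrite /rdisjoint r0 rmeet_id// rabs_ge0.
Qed.

Lemma rdisjointB x y z : rdisjoint x z -> rdisjoint y z -> rdisjoint (x - y) z.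
Proof.
move=> xz yz; apply: rdisjointD => //.
by rewrite -scaleN1r; exact: rdisjointZ.
Qed.

Lemma disjoint_band h : band [set x | rdisjoint x h].
Proof.
split=> [|a x y xh yh|x y xy yh|D x Dh [Dx xD]]; rewrite /=.
- exact: rdisjoint0.
- by apply: rdisjointD => //; exact: rdisjointZ.
- exact: rdisjoint_solid yh.
have [D0|/set0P[d Dd]] := eqVneq D set0.
  (* The supremum of the empty set is a least element, so it is null. *)
  have x_min y : x <= y by apply: xD => z; rewrite D0.
  suff -> : x = 0 by exact: rdisjoint0.
  apply/le_anti; rewrite x_min/=; have := x_min (x + x).
  by rewrite -{1}[x]add0r riesz_leD2E.
have Dh0 c : D c -> rmeet (rabs h) (rabs c) <= 0.
  by move=> /Dh ch; rewrite rmeetC (ch : _ = _).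
apply: rdisjointP; rewrite rmeetC; apply: rmeet_join_le.
  apply: (rmeet_sup_le (conj Dx xD)) => c Dc.
  by rewrite (le_trans _ (Dh0 _ Dc))// rmeet_le// le_rabs.
rewrite (le_trans _ (Dh0 _ Dd))// rmeet_le//.
by rewrite (le_trans _ (leN_rabs d))// riesz_leN2; exact: Dx.
Qed.

Lemma band_gen_band h : band (band_gen h).
Proof.
split=> [B [bB _]|a x y hx hy B BP|x y xy hy B BP|D x Dh xD B BP].
- exact: band0.
- by have [bB _] := BP; apply: bandP => //; [exact: hx|exact: hy].
- by have [bB _] := BP; apply: (band_solid bB xy); exact: hy.
- by have [bB _] := BP; apply: (band_sup bB _ xD) => d /Dh; exact.
Qed.

Lemma band_gen_self h : band_gen h h.
Proof. by move=> B []. Qed.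

Lemma band_le B x y : band B -> 0 <= x -> x <= y -> B y -> B x.
Proof.
by move=> bB x0 xy; apply: (band_solid bB); rewrite !rabs_pos// (le_trans x0).
Qed.

Lemma rdisjoint_gen x h z : rdisjoint x h -> band_gen h z -> rdisjoint x z.
Proof.
move=> xh; move=> /(_ [set y | rdisjoint y x]) hz; apply: rdisjoint_sym.
by apply: hz; split; [exact: disjoint_band|exact: rdisjoint_sym].
Qed.

End Disjointness.

(** * Band projections in a Dedekind complete space *)

Section BandProjections.
Context (R : realType) (V : rieszType R).
Hypothesis V_complete : dedekind_complete V.
Implicit Types (e x y z h k s w : V) (A B D : set V).

(** Characterises [P_h x]: two candidates differ by an element of the band that
    is disjoint from the band, hence from itself. *)
Lemma bproj_uniq h x y : band_gen h y -> rdisjoint (x - y) h -> bproj h x = y.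
Proof.
move=> hy xyh; rewrite /bproj /band_proj; apply: xget_unique.
  by split=> // z; exact: rdisjoint_gen.
move=> z [hz xz]; apply/eqP; rewrite -subr_eq0; apply/eqP/rdisjoint_self.
have hzy : band_gen h (z - y).
  rewrite -[z]scale1r -scaleN1r addrC.
  by apply: (bandP (band_gen_band h)) => //; rewrite scale1r.
have {1}-> : z - y = (x - y) - (x - z) by rewrite opprB [RHS]addrC subrKA.
apply: rdisjointB; last exact: xz.
by apply: rdisjoint_gen hzy.
Qed.

Lemma mulrn_meet_band h x n :
  0 <= h -> 0 <= x -> band_gen h (rmeet x (h *+ n)).
Proof.
move=> h0 x0; have hb := band_gen_band h.
apply: (@band_le _ _ _ _ (h *+ n) hb); last 1 first.
- rewrite -scaler_nat -[_ *: h]addr0.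
  by apply: (bandP hb); [exact: band_gen_self|exact: band0].
- by rewrite rmeet_ge// riesz_mulrn_ge0.
- exact: rmeetr.
Qed.

(** The usual formula [P_h x = sup_n (x /\ n h)]; with [s] the supremum and
    [w = (x - s) /\ h], each [x /\ n h + w] lies below [x /\ (n + 1) h <= s],
    so that [s + w <= s] and [w = 0]. *)
Lemma bproj_sup h x : 0 <= h -> 0 <= x ->
  [/\ supremums (range (fun n => rmeet x (h *+ n))) (bproj h x),
      band_gen h (bproj h x) & rdisjoint (x - bproj h x) h].
Proof.
move=> h0 x0; set D := range _.
have [||s sD] := V_complete (A := D).
- by exists (rmeet x (h *+ 0)); exists 0%N.
- by exists x => _ [m _ <-]; exact: rmeetl.
have [Ds Dmin] := sD.
have hs : band_gen h s.
  apply: (band_sup (band_gen_band h) _ sD) => _ [m _ <-].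
  exact: mulrn_meet_band.
have sx : s <= x by apply: Dmin => _ [m _ <-]; exact: rmeetl.
have xs0 : 0 <= x - s by rewrite riesz_subr_ge0.
suff xsh : rdisjoint (x - s) h by rewrite (bproj_uniq hs xsh); split.
apply: rdisjointP; rewrite !rabs_pos//; set w := rmeet _ _.
rewrite -(riesz_leD2E w 0 s) add0r addrC -riesz_leBrDr.
apply: Dmin => _ [m _ <-]; rewrite riesz_leBrDr.
apply: le_trans (Ds (rmeet x (h *+ m.+1)) _); last by exists m.+1.
apply: rmeet_ge; last by rewrite mulrSr riesz_leD ?rmeetr.
rewrite -[X in _ <= X](subrK s) [X in _ <= X]addrC.
by rewrite riesz_leD ?rmeetl//; apply: Ds; exists m.
Qed.

(** The formula above extends from positive [x] to all [x] by [x = x^+ - x^-]. *)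
Lemma bproj_spec h x : 0 <= h ->
  band_gen h (bproj h x) /\ rdisjoint (x - bproj h x) h.
Proof.
move=> h0; have [_ hp dp] := bproj_sup h0 (rpos_ge0 x).
have [_ hq dq] := bproj_sup h0 (rpos_ge0 (- x)).
set p := bproj h (rpos x) in hp dp; set q := bproj h (rpos (- x)) in hq dq.
suff [hpq dpq] : band_gen h (p - q) /\ rdisjoint (x - (p - q)) h.
  by rewrite (bproj_uniq hpq dpq).
split.
  by rewrite addrC -scaleN1r; apply: (bandP (band_gen_band h)).
have -> : x - (p - q) = (rpos x - p) - (rpos (- x) - q).
  by rewrite -{1}[x]rposBN !opprB ![q - _]addrC addrACA.
exact: rdisjointB.
Qed.

Lemma bproj_linear h a x y :
  0 <= h -> bproj h (a *: x + y) = a *: bproj h x + bproj h y.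
Proof.
move=> h0; have [hx dx] := bproj_spec x h0; have [hy dy] := bproj_spec y h0.
apply: bproj_uniq; first by apply: (bandP (band_gen_band h)).
rewrite opprD addrACA -scalerBr.
by apply: rdisjointD => //; exact: rdisjointZ.
Qed.

Lemma bprojD h x y : 0 <= h -> bproj h (x + y) = bproj h x + bproj h y.
Proof. by move=> h0; rewrite -[x]scale1r bproj_linear// !scale1r. Qed.

Lemma bprojB h x y : 0 <= h -> bproj h (x - y) = bproj h x - bproj h y.
Proof.
by move=> h0; rewrite addrC -scaleN1r bproj_linear// scaleN1r addrC.
Qed.

Lemma bproj_ge0 h x : 0 <= h -> 0 <= x -> 0 <= bproj h x.
Proof.
move=> h0 x0; have [[ub _] _ _] := bproj_sup h0 x0.
apply: le_trans (ub (rmeet x (h *+ 0)) _); last by exists 0%N.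
by rewrite rmeet_ge.
Qed.

Lemma bproj_le h x : 0 <= h -> 0 <= x -> bproj h x <= x.
Proof.
move=> h0 x0; have [[_ lub] _ _] := bproj_sup h0 x0.
by apply: lub => _ [m _ <-]; exact: rmeetl.
Qed.

Lemma bproj_mono h x y : 0 <= h -> x <= y -> bproj h x <= bproj h y.
Proof.
by move=> h0 xy; rewrite -riesz_subr_ge0 -bprojB// bproj_ge0// riesz_subr_ge0.
Qed.

(** For [x >= 0], let [z] be the part of [P_h (P_k x)] disjoint from [h /\ k].
    It lies in the bands of [h] and of [k] and satisfies [z /\ h /\ k = 0], which
    forces first [z /\ h = 0] and then [z = 0]. *)
Lemma bproj_meet h k x :
  0 <= h -> 0 <= k -> bproj h (bproj k x) = bproj (rmeet h k) x.
Proof.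
move=> h0 k0; have hk0 : 0 <= rmeet h k by rewrite rmeet_ge.
wlog x0 : x / 0 <= x => [hw|].
  by rewrite -[x]rposBN !bprojB// !hw ?rpos_ge0.
have px0 := bproj_ge0 k0 x0; have [_ kx dx] := bproj_sup k0 x0.
set y := bproj k x in px0 kx dx *; have py0 := bproj_ge0 h0 px0.
have [_ hy dy] := bproj_sup h0 px0; set t := bproj h y in py0 hy dy *.
apply/esym/bproj_uniq; last first.
  have -> : x - t = (x - y) + (y - t) by rewrite subrKA.
  apply: rdisjointD; apply/rdisjoint_sym.
    by apply: rdisjoint_le (rmeetr h k) (rdisjoint_sym dx).
  by apply: rdisjoint_le (rmeetl h k) (rdisjoint_sym dy).
have [_ pt dt] := bproj_sup hk0 py0.
suff z0 : t - bproj (rmeet h k) t = 0 by rewrite -[t]subr0 -z0 opprB addrC subrK.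
have zle := bproj_le hk0 py0; have pt0 := bproj_ge0 hk0 py0.
set z := t - _ in dt *.
have z0 : 0 <= z by rewrite riesz_subr_ge0.
have zt : z <= t by rewrite riesz_leBlDr -{1}[t]addr0 riesz_leD.
have hz : band_gen h z by exact: band_le (band_gen_band h) z0 zt hy.
have kz : band_gen k z.
  by apply: band_le (band_gen_band k) z0 (le_trans zt _) kx; exact: bproj_le.
have zh0 : 0 <= rmeet z h by rewrite rmeet_ge.
apply: rdisjoint_self; apply: rdisjoint_gen hz; apply: rdisjointP.
rewrite !rabs_pos//; suff -> : rmeet z h = 0 by [].
apply: rdisjoint_self; apply: (@rdisjoint_gen _ _ _ k).
  apply: rdisjointP; rewrite !rabs_pos//.
  rewrite -(rdisjoint_pos z0 hk0 dt); apply: rmeet_ge.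
    exact: le_trans (rmeetl _ _) (rmeetl _ _).
  apply: rmeet_ge; last exact: rmeetr.
  exact: le_trans (rmeetl _ _) (rmeetr _ _).
exact: band_le (band_gen_band k) zh0 (rmeetl _ _) kz.
Qed.

Lemma bproj_self h : 0 <= h -> bproj h h = h.
Proof.
move=> h0; apply: bproj_uniq; first exact: band_gen_self.
by rewrite subrr; exact: rdisjoint0.
Qed.

(** Off the band of [h = (x - y)^+], [x] stays below [y]. To see it, apply
    [P_h w <= w] to [w = (z - x) + h >= 0]; the two terms [P_h h] and [h]
    cancel. *)
Lemma bproj_compl_le x y z : y <= z ->
  x - bproj (rpos (x - y)) x <= z - bproj (rpos (x - y)) z.
Proof.
move=> yz; set h := rpos (x - y); have h0 : 0 <= h := rpos_ge0 _.
have w0 : 0 <= z - x + h.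
  rewrite addrC -riesz_leBlDr add0r opprB.
  by rewrite (le_trans _ (rpos_ge (x - y)))// riesz_leD// riesz_leN2.
have := bproj_le h0 w0; rewrite bprojD// bproj_self// riesz_leD2E bprojB//.
rewrite -riesz_subr_ge0 opprB => le_w; rewrite -riesz_subr_ge0 opprB.
by rewrite [_ - x]addrC addrACA [- _ + bproj h x]addrC.
Qed.

End BandProjections.

(** * Conditional expectations and band projections *)

Section CondExpCommutes.
Context (R : realType) (V : rieszType R).
Implicit Types (e x y z h k s w : V) (A B D : set V).

Lemma positive_mono (T : {linear V -> V}) x y :
  positive_op T -> x <= y -> T x <= T y.
Proof.
by move=> T_pos xy; rewrite -riesz_subr_ge0 -linearB T_pos// riesz_subr_ge0.
Qed.

(** Order continuity is stated for nets decreasing to [0]; it is applied to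
    [s - d] for [d] in [D]. *)
Lemma order_continuous_sup (T : {linear V -> V}) D s :
  positive_op T -> order_continuous T ->
  directed_up D -> supremums D s -> supremums (T @` D) (T s).
Proof.
move=> T_pos T_cont [[d0 Dd0] Ddir] [Ds sD].
pose D' := [set s - d | d in D].
have D'dir : directed_down D'.
  split; first by exists (s - d0), d0.
  move=> _ _ [x Dx <-] [y Dy <-]; have [z Dz [xz yz]] := Ddir _ _ Dx Dy.
  by exists (s - z); [exists z|rewrite ![s - _]addrC !riesz_leD2E !riesz_leN2].
have D'inf : infimums D' 0.
  split=> [_ [d Dd <-]|l lb]; first by rewrite riesz_subr_ge0; exact: Ds.
  have : s <= s - l.
    apply: sD => d Dd; rewrite riesz_leBrDr addrC -riesz_leBrDr.
    by apply: lb; exists d.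
  by rewrite riesz_leBrDr addrC -riesz_leBrDr subrr.
have [_ inf0] := T_cont _ D'dir D'inf.
split=> [_ [d Dd <-]|u ub]; first by apply: positive_mono => //; exact: Ds.
rewrite -[u]add0r -riesz_leBlDr; apply: inf0 => _ [_ [d Dd <-] <-].
apply: le_trans (le_rabs _); rewrite linearB !(addrC (T s)) -/(_ - _).
by rewrite riesz_leD2E riesz_leN2; apply: ub; exists d.
Qed.

Hypothesis V_complete : dedekind_complete V.

(** [e] generates everything as soon as nothing is disjoint from it, because
    [w - P_e w] is. *)
Lemma weak_order_unitP e : 0 <= e ->
  weak_order_unit e <-> (forall w, rdisjoint w e -> w = 0).
Proof.
move=> e0; split=> [[_ eT] w we|e_disj].
  by apply: rdisjoint_self; apply: rdisjoint_gen we _; rewrite eT.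
split=> //; apply/seteqP; split=> // w _.
have [ew dw] := bproj_spec V_complete w e0.
by rewrite -[w]subr0 -(e_disj _ dw) opprB addrC subrK.
Qed.

Variable T : {linear V -> V}.
Hypothesis T_exp : cond_exp T.

(** Order continuity carries the formula [P_h x = sup_n (x /\ n h)] through
    [T]. *)
Lemma cond_exp_band h x B : 0 <= h -> 0 <= x -> band_gen h x ->
  band B -> B (T h) -> B (T x).
Proof.
have T_pos := cond_exp_pos T_exp.
move=> h0 x0 hx bB BTh; have [xsup _ _] := bproj_sup V_complete h0 x0.
have px : bproj h x = x.
  by apply: bproj_uniq => //; rewrite subrr; exact: rdisjoint0.
rewrite px in xsup.
apply: (band_sup bB _ (order_continuous_sup T_pos (cond_exp_cont T_exp) _ xsup)).
  move=> _ [_ [n _ <-] <-]; apply: (@band_le _ _ _ _ (T h *+ n) bB).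
  - by rewrite T_pos// rmeet_ge// riesz_mulrn_ge0.
  - by rewrite -linearMn; apply: positive_mono => //; exact: rmeetr.
  - rewrite -scaler_nat -[_ *: _]addr0.
    by apply: (bandP bB) => //; exact: band0.
split; first by exists (rmeet x (h *+ 0)), 0%N.
move=> _ _ [m _ <-] [n _ <-]; exists (rmeet x (h *+ maxn m n)).
  by exists (maxn m n).
by split; apply: rmeet_le => //; apply: riesz_lemuln => //;
  rewrite ?leq_maxl ?leq_maxr.
Qed.

Lemma cond_exp_fix x : range T x -> T x = x.
Proof. by move=> [y _ <-]; rewrite cond_exp_proj. Qed.

Lemma cond_exp_range_riesz : riesz_subspace (range T).
Proof. by have [] := cond_exp_range T_exp. Qed.

(** A conditional expectation commutes with the band projections of its range.
    That [T] preserves the band of [h] is order continuity. For the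
    disjoint complement of [h], split a weak order unit [u] of the range as
    [P_h u + p]; the complement is the band of [p], and [T p = p]
    because [P_h u = sup_n (u /\ n h)] is again fixed by [T]. *)
Lemma cond_exp_bproj e h x : weak_order_unit e -> 0 <= h -> range T h ->
  T (bproj h x) = bproj h (T x).
Proof.
move=> eu h0 Th; have T_pos := cond_exp_pos T_exp.
have [u0 uT] := cond_exp_unit T_exp eu; set u := T e in u0 uT.
have Tu : T u = u by rewrite /u cond_exp_proj.
have pu0 := bproj_ge0 V_complete h0 u0; have pule := bproj_le V_complete h0 u0.
have [[_ pulub] hpu dpu] := bproj_sup V_complete h0 u0.
have Tpu : T (bproj h u) = bproj h u.
  apply/le_anti/andP; split; last first.
    apply: pulub => _ [n _ <-].
    have /cond_exp_fix <- : range T (rmeet u (h *+ n)).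
      apply: (riesz_subspaceI cond_exp_range_riesz); first by exists e.
      by exists (h *+ n) => //; rewrite linearMn cond_exp_fix.
    apply: positive_mono => //.
    have [[ub _] _ _] := bproj_sup V_complete h0 u0.
    by apply: ub; exists n.
  have hTpu : band_gen h (T (bproj h u)).
    apply: (cond_exp_band h0 pu0 hpu (band_gen_band h)).
    by rewrite cond_exp_fix//; exact: band_gen_self.
  rewrite -[T (bproj h u)](bproj_uniq (x := T (bproj h u)) hTpu); last first.
    by rewrite subrr; exact: rdisjoint0.
  apply: bproj_mono => //; rewrite -[X in _ <= X]Tu.
  exact: positive_mono.
set p := u - bproj h u in dpu.
have p0 : 0 <= p by rewrite riesz_subr_ge0.
have Tp : T p = p by rewrite linearB Tu Tpu.
have T_disj y : 0 <= y -> rdisjoint y h -> rdisjoint (T y) h.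
  move=> y0 yh; have py : bproj p y = y.
    have [_ py dy] := bproj_sup V_complete p0 y0.
    have ple := bproj_le V_complete p0 y0.
    have pge := bproj_ge0 V_complete p0 y0.
    set z := y - _ in dy; suff z0 : z = 0 by rewrite -[LHS]addr0 -z0 addrC subrK.
    apply: rdisjoint_self; apply: (@rdisjoint_gen _ _ _ u); last by rewrite uT.
    have -> : u = bproj h u + p by rewrite addrC subrK.
    apply: rdisjoint_sym; apply: rdisjointD; last exact: rdisjoint_sym.
    apply: rdisjoint_sym; apply: rdisjoint_gen hpu.
    apply: rdisjoint_le yh; first by rewrite riesz_subr_ge0.
    by rewrite riesz_leBlDr -{1}[y]addr0 riesz_leD.
  apply: (cond_exp_band p0 y0 _ (disjoint_band h)); last by rewrite Tp.
  by have [_] := bproj_sup V_complete p0 y0; rewrite py.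
wlog x0 : x / 0 <= x => [hw|].
  by rewrite -[x]rposBN bprojB// !linearB bprojB// !hw ?rpos_ge0.
have [_ hx dx] := bproj_sup V_complete h0 x0.
apply/esym/bproj_uniq.
  apply: (cond_exp_band h0 _ hx (band_gen_band h)); first exact: bproj_ge0.
  by rewrite cond_exp_fix//; exact: band_gen_self.
by rewrite -linearB; apply: T_disj => //; rewrite riesz_subr_ge0 bproj_le.
Qed.

End CondExpCommutes.

(** * The maximal inequality in a Dedekind complete space *)

Section MaximalInequality.
Context (R : realType) (V : rieszType R).
Hypothesis V_complete : dedekind_complete V.
Implicit Types (e g x y : V) (b : nat -> V).

Lemma big_rjoin_rcons x (F : nat -> V) s j :
  \big[rjoin/x]_(i <- rcons s j) F i = rjoin (\big[rjoin/x]_(i <- s) F i) (F j).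
Proof.
elim: s => [|i s IHs] /=; first by rewrite !big_cons !big_nil rjoinC.
by rewrite !big_cons IHs rjoinA.
Qed.

Lemma big_comp_rcons (F : nat -> V -> V) s j :
  \big[comp/idfun]_(i <- rcons s j) F i = (\big[comp/idfun]_(i <- s) F i) \o F j.
Proof.
elim: s => [|i s IHs] /=; first by rewrite !big_cons !big_nil.
by rewrite !big_cons IHs.
Qed.

Lemma index_iotaSr m n : (m <= n)%N ->
  index_iota m n.+1 = rcons (index_iota m n) n.
Proof. by move=> mn; rewrite /index_iota subSn// -addn1 iotaD cats1 subnKC. Qed.

(** The element whose band is [{g > b_1 \/ ... \/ b_n}]. *)
Definition excess g b n : V := rpos (g - \big[rjoin/b 1%N]_(2 <= i < n.+1) b i).

Lemma excess1 g b : excess g b 1 = rpos (g - b 1%N).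
Proof. by rewrite /excess big_geq. Qed.

Lemma excessS g b n : (0 < n)%N ->
  excess g b n.+1 = rmeet (excess g b n) (rpos (g - b n.+1)).
Proof.
by move=> n0; rewrite /excess index_iotaSr// big_rjoin_rcons rposBjoin.
Qed.

Lemma prod_bproj_excess g b n : (0 < n)%N ->
  \big[comp/idfun]_(1 <= i < n.+1) bproj (rpos (g - b i)) = bproj (excess g b n).
Proof.
case: n => // n _; elim: n => [|n IHn].
  by rewrite index_iotaSr// big_comp_rcons big_geq// excess1.
rewrite index_iotaSr// big_comp_rcons IHn (excessS _ _ (ltn0Sn n)).
apply/funext => x /=.
by rewrite bproj_meet// rpos_ge0.
Qed.

Lemma excess_closed (A : set V) g b n : riesz_subspace A -> A g -> (0 < n)%N ->
  (forall i, (0 < i)%N -> (i <= n)%N -> A (b i)) -> A (excess g b n).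
Proof.
move=> hA Ag n0 Ab; apply: (riesz_subspaceU hA); last exact: riesz_subspace0 hA.
rewrite addrC -scaleN1r; apply: (riesz_subspaceP hA) => //.
rewrite big_nat; elim/big_ind: _ => [|x y|i /andP[i2 i_n]]; first exact: Ab.
  exact: riesz_subspaceU hA _ _.
by apply: Ab => //; exact: leq_trans i2.
Qed.

(** Summation by parts. With [U_n] the projection on [{g > b_1, ..., g > b_n}],
    the part of [g] on [U_(n - 1) - U_n] lies below [b_n <= z_n]; the term
    [U_n z_n] on the left is what the next step of the induction consumes. *)
Lemma excess_pathwise b (z : nat -> V) g n :
  (forall i, (0 < i)%N -> b i <= z i) -> (0 < n)%N ->
  g - bproj (excess g b n) g + bproj (excess g b n) (z n) <=
    z 1%N + \sum_(1 <= i < n) bproj (excess g b i) (z i.+1 - z i).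
Proof.
move=> bz; have k0 i : 0 <= excess g b i := rpos_ge0 _.
case: n => // n _; elim: n => [|n IHn].
  rewrite [X in _ <= _ + X]big_geq// addr0 -riesz_leBrDr excess1.
  exact/bproj_compl_le/bz.
rewrite [X in _ <= _ + X]big_nat_recr//= addrA.
apply: le_trans (riesz_leD IHn (lexx _)).
have US x : bproj (excess g b n.+2) x =
    bproj (excess g b n.+1) (bproj (rpos (g - b n.+2)) x).
  by rewrite (excessS _ _ (ltn0Sn n)) bproj_meet// rpos_ge0.
have := bproj_mono V_complete (k0 n.+1)
  (bproj_compl_le V_complete g (bz n.+2 isT)).
rewrite !(bprojB V_complete)// -!US => le_g.
rewrite -[X in _ <= X]addrA [bproj _ (z n.+1) + _]addrC subrK.
set u := bproj (excess g b n.+1) in le_g *.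
set v := bproj (excess g b n.+2) in le_g *.
rewrite -!addrA riesz_leD// ![- _ + _]addrC.
rewrite -(subrKA (u g) (v _)) -(subrKA (v (z n.+2)) (u (z n.+2))).
by rewrite [X in X <= _]addrC riesz_leD2E.
Qed.

(** [Y^+] is again a submartingale. *)
Lemma submartingale_rpos (Y : nat -> V) Ti i j : submartingale Y Ti ->
  (0 < i)%N -> (i < j)%N -> rpos (Y i) <= Ti i (rpos (Y j)).
Proof.
move=> [filt _ sub] i0 ij.
have T_pos := cond_exp_pos (filtration_cond_exp filt i0).
apply: rjoin_le; last by rewrite T_pos// rpos_ge0.
by apply: le_trans (sub i j i0 ij) _; apply: positive_mono => //; exact: rpos_ge.
Qed.

Lemma filtration_range_le (Ti : nat -> {linear V -> V}) i j x : filtration Ti ->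
  (0 < i)%N -> (i <= j)%N -> range (Ti i) x -> range (Ti j) x.
Proof.
move=> filt i0; rewrite leq_eqVlt => /orP[/eqP <-//|ij] [y _ <-].
by exists (Ti i y) => //; have [_ ->] := filtration_compat filt i0 ij y.
Qed.

Lemma filtration_tower (Ti : nat -> {linear V -> V}) i j x : filtration Ti ->
  (0 < i)%N -> (i <= j)%N -> Ti i (Ti j x) = Ti i x.
Proof.
move=> filt i0; rewrite leq_eqVlt => /orP[/eqP <-|ij].
  exact/cond_exp_proj/(filtration_cond_exp filt).
by have [] := filtration_compat filt i0 ij x.
Qed.

(** [T_1 U_i = T_1 T_i U_i = T_1 U_i T_i] because [U_i] projects on the band of an
    element of the range of [T_i]; so [U_i] only meets the positive
    [T_i (Y_(i + 1)^+ - Y_i^+)], and can be dropped. *)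
Lemma maximal_inequality e (Y : nat -> V) Ti (a : nat -> R) g n :
  weak_order_unit e -> submartingale Y Ti ->
  (forall i, (0 < i)%N -> 0 < a i) ->
  (forall i, (0 < i)%N -> a i <= a i.+1) ->
  range (Ti 1%N) g -> (0 < n)%N ->
  Ti 1%N (g - bproj (excess g (fun i => (a i)^-1 *: Y i) n) g) <=
    (a 1%N)^-1 *: rpos (Y 1%N) +
    \sum_(1 <= i < n) Ti 1%N ((a i.+1)^-1 *: (rpos (Y i.+1) - rpos (Y i))).
Proof.
move=> eu Ysub a_gt0 a_nd Tg n0; have [filt Yad _] := Ysub.
have Texp := filtration_cond_exp filt; have T1exp := Texp _ (ltn0Sn 0).
have T1_pos := cond_exp_pos T1exp.
have aV_ge0 i : (0 < i)%N -> 0 <= (a i)^-1.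
  by move=> i0; rewrite invr_ge0 ltW ?a_gt0.
set b := fun i => _.
have rYp i : (0 < i)%N -> range (Ti i) (rpos (Y i)).
  move=> i0; have hr := cond_exp_range_riesz (Texp i i0).
  apply: (riesz_subspaceU hr); [exact: Yad|exact: riesz_subspace0 hr].
have Tk i : (0 < i)%N -> range (Ti i) (excess g b i).
  move=> i0; have hr := cond_exp_range_riesz (Texp i i0).
  apply: (excess_closed hr) => //; first exact: filtration_range_le Tg.
  move=> j j0 ji; rewrite -[b j]addr0.
  apply: (riesz_subspaceP hr); last exact: riesz_subspace0 hr.
  by apply: (filtration_range_le filt j0 ji); exact: Yad.
have k0 i : 0 <= excess g b i := rpos_ge0 _.
pose z i := (a i)^-1 *: rpos (Y i).
have bz i : (0 < i)%N -> b i <= z i.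
  by move=> i0; apply: riesz_leZ2l; [exact: aV_ge0|exact: rpos_ge].
have path : g - bproj (excess g b n) g <=
    z 1%N + \sum_(1 <= i < n) bproj (excess g b i)
      ((a i.+1)^-1 *: (rpos (Y i.+1) - rpos (Y i))).
  apply: (@le_trans _ _ (g - bproj (excess g b n) g
                         + bproj (excess g b n) (z n))).
    rewrite -[X in X <= _]addr0 riesz_leD// bproj_ge0// riesz_scale_ge0 ?aV_ge0//.
    exact: rpos_ge0.
  apply: le_trans (excess_pathwise g bz n0) _; apply: riesz_leD => //.
  rewrite !big_nat; elim/big_ind2: _ => // [x x' y y'|i /andP[i0 _]].
    exact: riesz_leD.
  apply: bproj_mono => //; rewrite scalerBr riesz_leD// riesz_leN2.
  by apply: riesz_leZ2r; rewrite ?rpos_ge0// lef_pV2 ?posrE ?a_gt0 ?a_nd.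
move: path => /(positive_mono T1_pos) /le_trans; apply.
rewrite linearD linearZ linear_sum (cond_exp_fix T1exp (rYp _ _))//.
apply: riesz_leD => //; rewrite !big_nat.
elim/big_ind2: _ => // [x x' y y'|i /andP[i0 _]]; first exact: riesz_leD.
set D := _ *: _; rewrite -(filtration_tower _ filt _ i0)//.
rewrite (cond_exp_bproj V_complete (Texp _ i0) _ eu)//; last exact: Tk.
rewrite -[X in _ <= X](filtration_tower _ filt _ i0)//.
apply: positive_mono => //; apply: bproj_le => //.
rewrite linearZ riesz_scale_ge0 ?aV_ge0// linearB riesz_subr_ge0.
rewrite (cond_exp_fix (Texp _ i0) (rYp _ i0)).
exact: submartingale_rpos.
Qed.

End MaximalInequality.

(** * The natural domain as an ideal of the universal completion *)

Section Ideals.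
Context (R : realType) (V : rieszType R) (A : set V) (hA : riesz_subspace A).

(** Suprema of a solid subspace are those of the whole space: a supremum lies
    between an element of the set and an upper bound. *)
Lemma solid_dedekind_complete : dedekind_complete V ->
  (forall x y, 0 <= x -> x <= y -> A y -> A x) ->
  dedekind_complete (sub_riesz hA).
Proof.
move=> V_complete A_solid D [d Dd] [u ubD].
pose D' := [set val x | x in D] : set V.
have [||s [ubs lubs]] := V_complete D'.
- by exists (val d), d.
- by exists (val u) => _ [x Dx <-]; have := ubD _ Dx; rewrite -Order.le_val.
have As : A s.
  have ds : val d <= s by apply: ubs; exists d.
  have su : s <= val u.
    by apply: lubs => _ [x Dx <-]; have := ubD _ Dx; rewrite -Order.le_val.
  rewrite -(subrK (val d) s) -[s - _]scale1r.
  apply: (riesz_subspaceP hA); last exact: set_mem (valP d).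
  apply: (A_solid _ (val u - val d)); rewrite ?riesz_subr_ge0//.
    exact: riesz_leD.
  rewrite -[val u]scale1r -scaleN1r addrC; apply: (riesz_subspaceP hA).
    exact: set_mem (valP d).
  by rewrite scale1r; exact: set_mem (valP u).
exists (Sub s (mem_set As)); split=> [x Dx|v ubv]; rewrite -Order.le_val SubK.
  by apply: ubs; exists x.
by apply: lubs => _ [x Dx <-]; have := ubv _ Dx; rewrite -Order.le_val.
Qed.

Lemma val_rjoin (x y : sub_riesz hA) : val (rjoin x y) = rjoin (val x) (val y).
Proof. by []. Qed.

Lemma val_rmeet (x y : sub_riesz hA) : val (rmeet x y) = rmeet (val x) (val y).
Proof. by []. Qed.

Lemma val_rdisjoint (x y : sub_riesz hA) :
  rdisjoint x y -> rdisjoint (val x) (val y).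
Proof.
move=> /(congr1 val); rewrite val_rmeet raddf0 => xy.
by rewrite /rdisjoint -xy /rabs !val_rjoin !raddfN.
Qed.

End Ideals.

Section OrderDense.
Context (R : realType) (E Eu : rieszType R) (iota : {linear E -> Eu}).
Hypothesis iota_completion : universal_completion iota.
Implicit Types (x y d : E) (u v w f h : Eu) (D : set E).

Lemma iota_le x y : (iota x <= iota y) = (x <= y).
Proof.
apply/idP/idP => [le_xy|le_xy].
  suff <- : rmeet x y = x by exact: rmeetr.
  apply: (ucompl_inj iota_completion).
  by rewrite (ucompl_meet iota_completion) rmeet_id.
by rewrite -(rmeet_id le_xy) (ucompl_meet iota_completion) rmeetr.
Qed.

Lemma iota_ge0 x : 0 <= x -> 0 <= iota x.
Proof. by rewrite -iota_le linear0. Qed.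

(** The order density of [E], in the form in which it is applied: a positive
    defect [v - rmeet u v] would dominate some [iota y] with [0 < y]. *)
Lemma iota_dense_le u v :
  (forall y, 0 <= y -> iota y <= v - rmeet u v -> y = 0) -> v <= u.
Proof.
move=> dense; have [d0|dn0] := eqVneq (v - rmeet u v) 0.
  have -> : v = rmeet u v by apply/eqP; rewrite -subr_eq0 d0.
  exact: rmeetl.
have [|y y0 yd] := ucompl_dense iota_completion (u := v - rmeet u v).
  by rewrite lt_def dn0 riesz_subr_ge0 rmeetr.
by have := y0; rewrite (dense y (ltW y0) yd) ltxx.
Qed.

Lemma iota_sup D s : supremums D s -> supremums (iota @` D) (iota s).
Proof.
move=> [ubs lubs]; split=> [_ [d Dd <-]|u ubu]; first by rewrite iota_le ubs.
apply: iota_dense_le => y y0 yd; apply/le_anti; rewrite y0 andbT.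
have : s <= s - y.
  apply: lubs => d Dd; rewrite -iota_le linearB riesz_leBrDr addrC -riesz_leBrDr.
  apply: le_trans yd _; rewrite riesz_leD// riesz_leN2.
  by apply: rmeet_ge; [apply: ubu; exists d|rewrite iota_le ubs].
by rewrite riesz_leBrDr addrC -riesz_leBrDr subrr.
Qed.

(** Every positive element of [Eu] is the supremum of the elements of [E] below
    it: if [s] is that supremum and [0 <= iota y <= h - s], then
    [x + y] is below [h] whenever [x] is, so that [s] could be lowered by
    [iota y]. *)
Lemma iota_sup_below h : 0 <= h ->
  supremums (iota @` [set x | 0 <= x /\ iota x <= h]) h.
Proof.
move=> h0; set D := [set x | _].
have [Eu_complete _] := ucompl_complete iota_completion.
have [||s [ubs lubs]] := Eu_complete (iota @` D).
- by exists (iota 0), 0 => //; split=> //; rewrite linear0.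
- by exists h => _ [x [_ xh] <-].
have sh : s <= h by apply: lubs => _ [x [_ xh] <-].
suff -> : h = s by [].
apply/le_anti; rewrite sh andbT; apply: iota_dense_le => y y0 yd.
rewrite rmeet_id// in yd; apply/le_anti; rewrite y0 andbT -iota_le linear0.
have : s <= s - iota y.
  apply: lubs => _ [x [x0 xh] <-]; rewrite riesz_leBrDr -linearD.
  apply: (ubs _ _); exists (x + y) => //; split; first exact: riesz_addr_ge0.
  rewrite linearD -[h](subrK s) [h - s + s]addrC; apply: riesz_leD => //.
  by apply: ubs; exists x.
by rewrite riesz_leBrDr addrC -riesz_leBrDr subrr.
Qed.

Context (T : {linear E -> E}).
Hypothesis T_exp : cond_exp T.

(** If the net [D] witnesses [f], the elements of [E] below [h] witness [h]:
    each such [x] is the supremum of the [x /\ d] for [d] in [D], so order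
    continuity of [T] bounds [T x] by any bound of [T D]. *)
Lemma T_dom_solid h f : 0 <= h -> h <= f -> T_dom iota T f -> T_dom iota T h.
Proof.
have T_pos := cond_exp_pos T_exp.
move=> h0 hf [f0 [D [D0 [[d0 Dd0] Ddir] fsup [_ [u ubu]]]]]; split=> //.
exists [set x | 0 <= x /\ iota x <= h]; split.
- by move=> x [].
- split; first by exists 0; split=> //; rewrite linear0.
  move=> x y [x0 xh] [y0 yh]; exists (rjoin x y); last by rewrite rjoinl rjoinr.
  split; first by rewrite (le_trans x0)// rjoinl.
  by rewrite (ucompl_join iota_completion) rjoin_le.
- exact: iota_sup_below.
split; first by exists 0 => _ [x [x0 _] <-]; rewrite iota_ge0// T_pos.
exists u => _ [x [x0 xh] <-].
pose C := [set rmeet x d | d in D].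
have Csup : supremums C x.
  split=> [_ [d _ <-]|w ubw]; first exact: rmeetl.
  rewrite -iota_le -(rmeet_id (le_trans xh hf)).
  apply: rmeet_sup_le fsup _ => _ [d Dd <-].
  by rewrite -(ucompl_meet iota_completion) iota_le; apply: ubw; exists d.
have Cdir : directed_up C.
  split; first by exists (rmeet x d0), d0.
  move=> _ _ [d Dd <-] [d' Dd' <-]; have [c Dc [dc d'c]] := Ddir _ _ Dd Dd'.
  by exists (rmeet x c); [exists c|split; exact: rmeet_le].
have [_ lub] := iota_sup
  (order_continuous_sup T_pos (cond_exp_cont T_exp) Cdir Csup).
apply: lub => _ [_ [_ [d Dd <-] <-] <-].
apply: (@le_trans _ _ (iota (T d))); last by apply: ubu; exists d.
by rewrite iota_le; apply: positive_mono => //; exact: rmeetr.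
Qed.

Lemma natural_domain_solid h f :
  0 <= h -> h <= f -> natural_domain iota T f -> natural_domain iota T h.
Proof.
move=> h0 hf [p domp [q [q0 _] pqf]]; exists h; last first.
  exists 0; last by rewrite subr0.
  split=> //; exists [set 0]; split=> [_ ->|||] //=.
  - by split=> [|x y -> ->]; exists 0.
  - by rewrite image_set1 linear0 supremums1.
  - by rewrite image_set1 !linear0; split; exists 0 => x ->.
apply: (T_dom_solid h0 _ domp); apply: le_trans hf _.
by rewrite -pqf riesz_leBlDr -{1}[p]addr0 riesz_leD.
Qed.

Lemma L1_dedekind_complete : dedekind_complete (L1 iota_completion T_exp).
Proof.
apply: solid_dedekind_complete; last exact: natural_domain_solid.
by have [] := ucompl_complete iota_completion.
Qed.

Lemma natural_domain_iota x : 0 <= x -> natural_domain iota T (iota x).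
Proof.
move=> x0; have dom_iota y : 0 <= y -> T_dom iota T (iota y).
  move=> y0; split; first exact: iota_ge0.
  exists [set y]; split=> [_ ->|||] //=.
  - by split=> [|? ? -> ->]; exists y.
  - by rewrite image_set1 supremums1.
  - by rewrite image_set1; split; exists (iota (T y)) => ? ->.
exists (iota x); first exact: dom_iota.
by exists (iota 0); [exact: dom_iota|rewrite linear0 subr0].
Qed.

(** [iota e] is a weak order unit of the natural domain: a nonzero element
    disjoint from [iota e] would dominate some [iota y] with [y > 0]
    disjoint from [e]. *)
Lemma L1_weak_order_unit (e : E) : weak_order_unit e ->
  exists e1 : L1 iota_completion T_exp, weak_order_unit e1.
Proof.
move=> [e0 eE].
pose e1 : L1 iota_completion T_exp :=
  Sub (iota e) (mem_set (natural_domain_iota e0)).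
have e1_val : val e1 = iota e by rewrite SubK.
exists e1; apply/(weak_order_unitP L1_dedekind_complete).
  by rewrite -Order.le_val raddf0 e1_val iota_ge0.
move=> w /val_rdisjoint; rewrite e1_val => we; apply/val_inj; rewrite raddf0.
apply: rdisjoint_self.
have absw0 : rabs (val w) <= 0.
  apply: iota_dense_le => y y0; rewrite rmeet_id ?rabs_ge0// subr0 => yw.
  apply: rdisjoint_self; apply: (@rdisjoint_gen _ _ _ e); last by rewrite eE.
  apply: rdisjointP; rewrite !rabs_pos// -iota_le (ucompl_meet iota_completion).
  rewrite linear0 -we; apply: rmeet_le => //.
  by rewrite rabs_pos// iota_ge0.
apply: rdisjointP; exact: le_trans (rmeetl _ _) absw0.
Qed.

End OrderDense.

Theorem theorem4p2 (R : realType) (E Eu : rieszType R) (e : E)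
    (E_complete : dedekind_complete E) (e_unit : weak_order_unit e)
    (iota : {linear E -> Eu}) (Eu_completion : universal_completion iota)
    (T : {linear E -> E}) (T_exp : cond_exp T) (T_pos : strictly_positive T)
    (Y : nat -> L1 Eu_completion T_exp)
    (Ti : nat -> {linear L1 Eu_completion T_exp -> L1 Eu_completion T_exp})
    (Y_sub : submartingale Y Ti)
    (a : nat -> R) (a_gt0 : forall i, (0 < i)%N -> 0 < a i)
    (a_nd : forall i j, (0 < i)%N -> (i <= j)%N -> a i <= a j)
    (g : L1 Eu_completion T_exp) (g_range : range (Ti 1%N) g) (g_ge0 : 0 <= g)
    (n : nat) (n_gt0 : (0 < n)%N) :
  let U := \big[comp/idfun]_(1 <= i < n.+1)
             bproj (rpos (g - (a i)^-1 *: Y i)) in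
  U = bproj (rpos (g - \big[rjoin/(a 1%N)^-1 *: Y 1%N]_(2 <= i < n.+1)
                         ((a i)^-1 *: Y i))) /\
  Ti 1%N (g - U g) <=
    (a 1%N)^-1 *: rpos (Y 1%N) +
    \sum_(1 <= i < n)
       Ti 1%N ((a i.+1)^-1 *: (rpos (Y i.+1) - rpos (Y i))).
Proof.
have V_complete : dedekind_complete (L1 Eu_completion T_exp).
  exact: L1_dedekind_complete.
have [e1 e1_unit] := L1_weak_order_unit Eu_completion T_exp e_unit.
move=> U; have UE : U = bproj (excess g (fun i => (a i)^-1 *: Y i) n).
  exact: prod_bproj_excess.
split; first exact: UE.
rewrite UE; apply: (maximal_inequality V_complete e1_unit Y_sub) => // i i0.
exact: a_nd.
Qed.
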